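(* Let $\mathbf F_\bullet:\ 0 \to F_\ell \xrightarrow{\phi_\ell} F_{\ell-1} \to \cdots \to F_1 \xrightarrow{\phi_1} F_0$ be a finite exact complex of free $R$-modules of finite ranks. Then for almost all $\alpha$ the sequence $(\mathbf F_\bullet)_\alpha:\ 0 \to (F_\ell)_\alpha \xrightarrow{(\phi_\ell)_\alpha} (F_{\ell-1})_\alpha \to \cdots \to (F_1)_\alpha \xrightarrow{(\phi_1)_\alpha} (F_0)_\alpha$ is an exact complex of free $R_\alpha$-modules of finite ranks.
   Context: Let $k$ be an arbitrary infinite field, $u=(u_1,\ldots,u_m)$ and $x=(x_1,\ldots,x_n)$ indeterminates, and $R=k(u)[x]$. Let $K$ be an extension field of $k$; for $\alpha=(\alpha_1,\ldots,\alpha_m)\in K^m$ put $R_\alpha=k(\alpha)[x]=k(\alpha_1,\ldots,\alpha_m)[x_1,\ldots,x_n]$. A property holds for almost all $\alpha$ if it holds for all $\alpha\in K^m$ except perhaps those lying on a proper algebraic subvariety of $K^m$ (which may depend on the given data). Every $a\in R$ can be written $a(u,x)=p(u,x)/q(u)$ with $p\in k[u,x]$, $q\in k[u]\setminus\{0\}$; for $\alpha$ with $q(\alpha)\neq 0$ put $a(\alpha,x)=p(\alpha,x)/q(\alpha)\in R_\alpha$. For a matrix $A=(a_{ij}(u,x))$ over $R$ put $A_\alpha=(a_{ij}(\alpha,x))$; this is defined for almost all $\alpha$. The specialization $F_\alpha$ of a free $R$-module $F$ of finite rank is a free $R_\alpha$-module of the same rank. Fix bases of all the free $R$-modules involved and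 of their specializations. If $\phi:F\to G$ is a homomorphism of free $R$-modules of finite ranks with matrix $A$, its specialization $\phi_\alpha:F_\alpha\to G_\alpha$ is the homomorphism with matrix $A_\alpha$ (whenever $A_\alpha$ is defined). A complex $0\to F_\ell\to\cdots\to F_0$ is called exact if it is exact at $F_\ell,\ldots,F_1$ (no condition at $F_0$). *)

(* Defs.v *)
From HB Require Import structures.
From mathcomp Require Import all_boot all_order all_algebra fraction.
From mathcomp Require Import mpoly.
From mathcomp Require Import boolp classical_sets functions cardinality.

Set Implicit Arguments.
Unset Strict Implicit.
Unset Printing Implicit Defensive.

Import GRing.Theory.
Local Open Scope ring_scope.

(* k(u) and R = k(u)[x], for u = (u_1, ..., u_m) and x = (x_1, ..., x_n). *)
Notation ratfun k m := {fraction {mpoly k[m]}}.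
Notation polyratfun k m n := {mpoly (ratfun k m)[n]}.

Section AlmostAll.
Variables (K : fieldType) (m : nat).
Local Open Scope classical_set_scope.

Definition zero_locus (s : seq {mpoly K[m]}) : set ('I_m -> K) :=
  [set a | forall f, f \in s -> f.@[a] = 0].

Definition algebraic_set (V : set ('I_m -> K)) : Prop :=
  exists s, V = zero_locus s.

Definition almost_all (P : ('I_m -> K) -> Prop) : Prop :=
  exists V : set ('I_m -> K),
    [/\ algebraic_set V, V <> setT & forall a, ~ V a -> P a].

End AlmostAll.

Lemma eq_mulVf (F : fieldType) (a b x y : F) : a != 0 -> b != 0 ->
  a^-1 * x = b^-1 * y <-> x * b = y * a.
Proof.
move=> a0 b0; rewrite ![_^-1 * _]mulrC.
by split=> [/eqP|/eqP xy]; [rewrite eqr_div // => /eqP | apply/eqP; rewrite eqr_div].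
Qed.

Section Adjoin.
Variables (k K : fieldType) (iota : {rmorphism k -> K}).
Variables (m : nat) (alpha : 'I_m -> K).

(* p(alpha), computed in the extension K of k *)
Definition evalK (p : {mpoly k[m]}) : K := mmap iota alpha p.

Fact evalK_is_zmod_morphism : zmod_morphism evalK.
Proof. by move=> p q; rewrite /evalK raddfB. Qed.

Fact evalK_is_monoid_morphism : monoid_morphism evalK.
Proof. by split=> [|p q]; rewrite /evalK ?rmorph1 ?rmorphM. Qed.

HB.instance Definition _ :=
  GRing.isZmodMorphism.Build {mpoly k[m]} K evalK evalK_is_zmod_morphism.
HB.instance Definition _ :=
  GRing.isMonoidMorphism.Build {mpoly k[m]} K evalK evalK_is_monoid_morphism.

(* The subfield k(alpha_1, ..., alpha_m) of K. *)
Definition adjoin_pred : {pred K} := fun z =>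
  `[< exists p q : {mpoly k[m]}, evalK q != 0 /\ z = evalK p / evalK q >].

Fact adjoin_divring_closed : GRing.divring_closed adjoin_pred.
Proof.
split.
- by apply/asboolP; exists 1, 1; rewrite rmorph1 oner_neq0 divr1.
- move=> x y /asboolP[p [q [q0 ->]]] /asboolP[p' [q' [q0' ->]]].
  apply/asboolP; exists (p * q' - p' * q), (q * q').
  rewrite rmorphB !rmorphM mulf_neq0 //; split=> //.
  by rewrite -[in LHS]mulNr addf_div // mulNr.
- move=> x y /asboolP[p [q [q0 ->]]] /asboolP[p' [q' [q0' ->]]].
  apply/asboolP; have [p0|p0] := eqVneq (evalK p') 0.
    by exists 0, 1; rewrite p0 mul0r invr0 mulr0 rmorph0 mul0r rmorph1 oner_neq0.
  exists (p * q'), (q * p'); rewrite !rmorphM mulf_neq0 //; split=> //.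
  by rewrite invf_div mulf_div.
Qed.

HB.instance Definition _ :=
  GRing.isDivringClosed.Build K adjoin_pred adjoin_divring_closed.

Record adjoin : Type := Adjoin { adjoin_val : K; _ : adjoin_val \in adjoin_pred }.

HB.instance Definition _ := [isSub for adjoin_val].
HB.instance Definition _ := [Choice of adjoin by <:].
HB.instance Definition _ := [SubChoice_isSubIntegralDomain of adjoin by <:].
HB.instance Definition _ := [SubIntegralDomain_isSubField of adjoin by <:].

Fact evalK_adjoin (p : {mpoly k[m]}) : evalK p \in adjoin_pred.
Proof. by apply/asboolP; exists p, 1; rewrite rmorph1 oner_neq0 divr1. Qed.

Definition evalA (p : {mpoly k[m]}) : adjoin := Adjoin (evalK_adjoin p).

Fact evalA_is_zmod_morphism : zmod_morphism evalA.
Proof. by move=> p q; apply: val_inj; rewrite /= rmorphB. Qed.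

Fact evalA_is_monoid_morphism : monoid_morphism evalA.
Proof. by split=> [|p q]; apply: val_inj; rewrite /= ?rmorph1 ?rmorphM. Qed.

HB.instance Definition _ :=
  GRing.isZmodMorphism.Build {mpoly k[m]} adjoin evalA evalA_is_zmod_morphism.
HB.instance Definition _ :=
  GRing.isMonoidMorphism.Build {mpoly k[m]} adjoin evalA
    evalA_is_monoid_morphism.

(* "a(alpha, x) is defined and equal to b": for some representation
   a(u, x) = p(u, x) / q(u) with q(alpha) != 0, b = p(alpha, x) / q(alpha).
   k[u, x] is represented as k[u][x]. *)
Definition specializes n (a : polyratfun k m n) (b : {mpoly adjoin[n]}) : Prop :=
  exists (p : {mpoly {mpoly k[m]}[n]}) (q : {mpoly k[m]}),
    [/\ evalA q != 0,
        a = (tofrac q)^-1 *: map_mpoly (@tofrac _) p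
      & b = (evalA q)^-1 *: map_mpoly evalA p].

(* a(alpha, x) does not depend on the representation. *)
Lemma specializes_functional n (a : polyratfun k m n) (b b' : {mpoly adjoin[n]}) :
  specializes a b -> specializes a b' -> b = b'.
Proof.
move=> [p [q [q0 -> ->]]] [p' [q' [q0' aE ->]]]; apply/mpolyP => mu.
have [t0 t0'] : tofrac q != 0 /\ tofrac q' != 0.
  by rewrite !tofrac_eq0; split; [apply: contraNneq q0 | apply: contraNneq q0'];
    move=> ->; rewrite rmorph0.
have pq : p@_mu * q' = p'@_mu * q.
  apply/eqP; rewrite -tofrac_eq !rmorphM; apply/eqP; apply/(eq_mulVf _ _ t0 t0').
  by rewrite -!mcoeff_map_mpoly -!mcoeffZ aE.
rewrite !mcoeffZ !mcoeff_map_mpoly; apply/(eq_mulVf _ _ q0 q0').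
by rewrite -[LHS]rmorphM -[RHS]rmorphM pq.
Qed.

Definition specializes_mx n s t (A : 'M[polyratfun k m n]_(s, t))
    (B : 'M[{mpoly adjoin[n]}]_(s, t)) : Prop :=
  forall i j, specializes (A i j) (B i j).

End Adjoin.

Section FreeModules.
Variable S : nzRingType.

Definition is_basis (V : lmodType S) r (e : 'I_r -> V) : Prop :=
  forall v, exists! c : 'rV[S]_r, v = \sum_i c 0 i *: e i.

(* Row convention: row i of A holds the coordinates of phi (e i), so that in
   coordinates phi is the map v |-> v *m A on row vectors. *)
Definition is_matrix (V W : lmodType S) r s (e : 'I_r -> V) (f : 'I_s -> W)
    (phi : V -> W) (A : 'M[S]_(r, s)) : Prop :=
  forall i, phi (e i) = \sum_j A i j *: f j.

(* 0 -> F l -> ... -> F 1 -> F 0, with phi i : F i.+1 -> F i (so that phi i is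
   the map usually written phi_(i+1)), is a complex exact at F l, ..., F 1.
   Only F 0, ..., F l and phi 0, ..., phi l.-1 matter. *)
Definition exact_complex (l : nat) (F : nat -> lmodType S)
    (phi : forall i, {linear F i.+1 -> F i}) : Prop :=
  (forall i, i.+1 = l -> forall v, phi i v = 0 -> v = 0) /\
  (forall i, (i.+1 < l)%N ->
     forall v, phi i v = 0 <-> exists w, v = phi i.+1 w).

Definition row_modules (r : nat -> nat) (i : nat) : lmodType S := 'rV[S]_(r i).

Definition mx_complex (r : nat -> nat) (B : forall i, 'M[S]_(r i.+1, r i))
    (i : nat) : {linear row_modules r i.+1 -> row_modules r i} :=
  mulmxr (B i).

End FreeModules.

(* Main.v *)
(* Each differential A_i has a set-theoretic section h_i on its image,
   h_i(w A_i) A_i = w A_i, given by division with remainder by a Groebner basis: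
   finitely many leading coefficients are inverted, so only finitely many
   denominators q(u) occur and h_i specializes wherever they do not vanish.
   Over R, exactness gives v = h_i(v A_i) + h_{i+1}(v - h_i(v A_i)) A_{i+1}
   (without the last term in top degree).  A cycle v' over k(alpha)[x]
   need not lift to a cycle, but it lifts to some v; then v A_i specializes to 0,
   hence so does h_i(v A_i), and the identity exhibits v' as a boundary. *)
Require Import Defs.
From HB Require Import structures.
From mathcomp Require Import all_boot all_order all_algebra fraction.
From mathcomp Require Import mpoly.
From mathcomp Require Import boolp classical_sets functions cardinality.
From mathcomp Require Import generic_quotient.

Set Implicit Arguments.
Unset Strict Implicit.
Unset Printing Implicit Defensive.

Import GRing.Theory.
Local Open Scope ring_scope.

(** * Nonvanishing over infinite fields, and Dickson's lemma *)

Lemma poly_nonroot (k : fieldType) (p : {poly k}) :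
  infinite_set [set: k]%classic -> p != 0 -> exists x, p.[x] != 0.
Proof.
move=> inf_k p_neq0; have [B _ sizeB] := infinite_set_fset (size p) inf_k.
have : ~~ all (root p) (finmap.enum_fset B).
  apply: contraL sizeB => /(max_poly_roots p_neq0)/(_ (finmap.fset_uniq B)).
  by rewrite -ltnNge.
by case/allPn => x _ rootx; exists x.
Qed.

(** [muni] splits off the last variable, so a monomial contributes exactly when it agrees with [m]
    on the first [n] exponents and on the last one. *)
Lemma coef_muni (R : nzRingType) n (p : {mpoly R[n.+1]}) (m : 'X_{1..n.+1}) :
  (muni p)`_(m ord_max)
    @_[multinom m (widen_ord (leqnSn n) i) | i < n] = p@_m.
Proof.
rewrite muniE coef_sum raddf_sum /= [RHS](congr1 (mcoeff m) (mpolyE p)) raddf_sum.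
apply: eq_bigr => m' _ /=; rewrite coefZ coefXn mulr_natr.
rewrite mcoeffMn !mcoeffZ !mcoeffX -mulrnAr -mulrnA mulnb; congr (_ * (nat_of_bool _)%:R).
apply/andP/eqP => [[/eqP eq_m /eqP eq_max]|->]; last by rewrite !eqxx.
apply/mnmP => i; case: (unliftP ord_max i) => [j ->|->//].
have -> : lift ord_max j = widen_ord (leqnSn n) j.
  by apply: val_inj; rewrite /= /bump leqNgt ltn_ord.
by move/mnmP/(_ j): eq_m; rewrite !mnmE.
Qed.

(** Induction on the number of variables: a point where one coefficient of [muni p] survives leaves
    a nonzero univariate polynomial in the last variable. *)
Lemma mpoly_nonroot (k : fieldType) n (p : {mpoly k[n]}) :
  infinite_set [set: k]%classic -> p != 0 -> exists a, p.@[a] != 0.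
Proof.
move=> inf_k; elim: n p => [|n IHn] p p_neq0.
  exists (fun=> 0); move: p_neq0.
  by rewrite [p]nvar0_mpolyC mevalC mpolyC_eq0.
pose m := mlead p.
have /IHn[a' a'P] : (muni p)`_(m ord_max) != 0.
  apply: contraNneq p_neq0 => coef0.
  by rewrite -mleadc_eq0 -coef_muni coef0 mcoeff0.
have /(poly_nonroot inf_k)[b bP] : map_poly (meval a') (muni p) != 0.
  by apply: contraNneq a'P => map0; rewrite -coef_map map0 coef0.
exists (fun i => oapp a' b (unlift ord_max i)); apply: contraNneq bP.
move=> p_eq0; rewrite -[X in _ == X]p_eq0 mevalE muniE rmorph_sum /= horner_sum.
apply/eqP/eq_bigr => m' _; rewrite -mul_polyC rmorphM /= map_polyC map_polyXn.
rewrite hornerCM hornerXn /= mevalZ mevalX big_ord_recr /= unlift_none /= mulrA.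
congr (_ * _ * _); apply: eq_bigr => i _; rewrite mnmE.
have -> : widen_ord (leqnSn n) i = lift ord_max i.
  by apply: val_inj; rewrite /= /bump leqNgt ltn_ord.
by rewrite liftK.
Qed.

(** Induction on [n]: a finite basis of the projection along the last exponent handles all monomials
    of large last exponent, and the finitely many remaining slices are handled one by one. *)
Lemma dickson n (S : 'X_{1..n} -> Prop) :
  exists2 s : seq 'X_{1..n}, forall m, m \in s -> S m &
    forall m, S m -> exists2 m', m' \in s & (m' <= m)%MM.
Proof.
elim: n S => [|n IHn] S.
  have [S0|nS0] := pselect (S 0%MM).
    exists [:: 0%MM] => [m|m _]; first by rewrite inE => /eqP->.
    by exists 0%MM; rewrite ?inE //; apply/mnm_lepP => -[].
  by exists [::] => // m; rewrite nvar0_mnmE => /nS0.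
pose glue (t : 'X_{1..n}) j : 'X_{1..n.+1} :=
  [multinom oapp t j (unlift ord_max i) | i < n.+1].
pose rest (m : 'X_{1..n.+1}) : 'X_{1..n} := [multinom m (lift ord_max i) | i < n].
have glueK m : glue (rest m) (m ord_max) = m.
  apply/mnmP => i; rewrite mnmE.
  by case: unliftP => [j ->|->] //=; rewrite mnmE.
have le_glue t j m : (t <= rest m)%MM -> (j <= m ord_max)%N -> (glue t j <= m)%MM.
  move=> /mnm_lepP le_t le_j; apply/mnm_lepP => i; rewrite mnmE.
  by case: unliftP => [i' ->|->] //=; have := le_t i'; rewrite mnmE.
have /choice[s sP] : forall j, exists s : seq 'X_{1..n},
    (forall t, t \in s -> S (glue t j)) /\
    (forall t, S (glue t j) -> exists2 t', t' \in s & (t' <= t)%MM).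
  by move=> j; have [s ? ?] := IHn (fun t => S (glue t j)); exists s.
have [s0 s0S s0P] := IHn (fun t => exists j, S (glue t j)).
have /choice[f fP] : forall t, exists j, t \in s0 -> S (glue t j).
  move=> t; have [/s0S[j Sj]|_] := boolP (t \in s0); last by exists 0%N.
  by exists j.
(* [f t] is a height at which [t] occurs in [S]. At height [N] or above, the last exponent never
   obstructs divisibility by [glue t (f t)]. *)
pose N := \max_(t <- s0) f t.
exists ([seq glue t (f t) | t <- s0] ++ [seq glue t j | j <- iota 0 N, t <- s j]).
  move=> m; rewrite mem_cat => /orP[/mapP[t ts0 ->]|]; first exact: fP.
  by case/allpairsPdep => j [t [_ ts ->]]; apply: (sP j).1.
move=> m Sm; have [ltN|geN] := ltnP (m ord_max) N.
  have [|t ts le_t] := (sP (m ord_max)).2 (rest m); first by rewrite glueK.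
  exists (glue t (m ord_max)); last exact: le_glue.
  by rewrite mem_cat (allpairs_f_dep _ (s := iota 0 N) (t := s)) ?orbT // mem_iota.
have [|t ts le_t] := s0P (rest m); first by exists (m ord_max); rewrite glueK.
exists (glue t (f t)); first by rewrite mem_cat (map_f (fun t => glue t (f t))).
apply: le_glue => //; apply: leq_trans geN.
exact: (@leq_bigmax_seq _ _ _ f).
Qed.

(** * Compatibility of specialization with ring and matrix operations *)

Lemma addf_scale (F : fieldType) (V : lmodType F) (x y : F) (u v : V) :
  x != 0 -> y != 0 ->
  x^-1 *: u + y^-1 *: v = (x * y)^-1 *: (y *: u + x *: v).
Proof.
move=> x0 y0; rewrite scalerDr !scalerA invfM mulfVK //.
by rewrite [_ / y]mulrC mulfVK.
Qed.

Lemma mulf_scale (F : fieldType) (A : algType F) (x y : F) (u v : A) :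
  (x^-1 *: u) * (y^-1 *: v) = (x * y)^-1 *: (u * v).
Proof. by rewrite -scalerAl -scalerAr scalerA invfM. Qed.

Section Specialization.
Variables (k K : fieldType) (iota : {rmorphism k -> K}) (m n : nat).
Variable alpha : 'I_m -> K.

Local Notation R := (polyratfun k m n).
Local Notation Ra := {mpoly (adjoin iota alpha)[n]}.
Local Notation spec := (@specializes _ _ iota m alpha n).
Local Notation spec_mx := (specializes_mx (iota := iota) (alpha := alpha)).

Lemma tofrac_neq0 (q : {mpoly k[m]}) : evalA iota alpha q != 0 -> tofrac q != 0.
Proof. by apply: contraNneq => /eqP; rewrite tofrac_eq0 => /eqP ->; rewrite rmorph0. Qed.

Lemma specializesD a b a' b' : spec a b -> spec a' b' -> spec (a + a') (b + b').
Proof.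
move=> [p [q [q0 -> ->]]] [p' [q' [q'0 -> ->]]].
have [t0 t'0] := (tofrac_neq0 q0, tofrac_neq0 q'0).
exists (q' *: p + q *: p'), (q * q'); split; first by rewrite rmorphM mulf_neq0.
  by rewrite (addf_scale _ _ t0 t'0) rmorphD /= !map_mpolyZ rmorphM.
by rewrite (addf_scale _ _ q0 q'0) rmorphD /= !map_mpolyZ rmorphM.
Qed.

Lemma specializesM a b a' b' : spec a b -> spec a' b' -> spec (a * a') (b * b').
Proof.
move=> [p [q [q0 -> ->]]] [p' [q' [q'0 -> ->]]].
exists (p * p'), (q * q'); split; first by rewrite rmorphM mulf_neq0.
  by rewrite (mulf_scale (tofrac q)) !rmorphM.
by rewrite (mulf_scale (evalA iota alpha q)) !rmorphM.
Qed.

Lemma specializes_map (p : {mpoly {mpoly k[m]}[n]}) :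
  spec (map_mpoly (@tofrac _) p) (map_mpoly (evalA iota alpha) p).
Proof. by exists p, 1; rewrite !rmorph1 !invr1 !scale1r oner_neq0. Qed.

Lemma specializes0 : spec 0 0.
Proof. by have := specializes_map 0; rewrite !rmorph0. Qed.

Lemma specializesX mu : spec 'X_[mu] 'X_[mu].
Proof. by have := specializes_map 'X_[mu]; rewrite !map_mpolyX. Qed.

Lemma specializesN a b : spec a b -> spec (- a) (- b).
Proof.
move=> ab; have := specializesM (specializes_map (- 1)) ab.
by rewrite !rmorphN1 !mulN1r.
Qed.

Lemma specializes_sum I (s : seq I) (f : I -> R) (g : I -> Ra) :
  (forall i, spec (f i) (g i)) -> spec (\sum_(i <- s) f i) (\sum_(i <- s) g i).
Proof.
move=> fg; elim: s => [|i s IHs]; first by rewrite !big_nil; exact: specializes0.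
by rewrite !big_cons; exact: specializesD.
Qed.

Lemma specializes_coef a b mu : spec a b -> spec (a@_mu)%:MP (b@_mu)%:MP.
Proof.
move=> [p [q [q0 -> ->]]]; exists (p@_mu)%:MP, q; split=> //.
  by rewrite map_mpolyC mcoeffZ mcoeff_map_mpoly mpolyCM mul_mpolyC.
by rewrite map_mpolyC mcoeffZ mcoeff_map_mpoly mpolyCM mul_mpolyC.
Qed.

(** Coefficientwise: an element of k(alpha) is p(alpha)/q(alpha) with q(alpha) nonzero, and p/q
    lifts it. *)
Lemma specializes_lift (b : Ra) : exists a, spec a b.
Proof.
have /choice[a aP] : forall mu, exists a, spec a (b@_mu *: 'X_[mu]).
  move=> mu; have /asboolP[p [q [q0 bE]]] := valP (b@_mu).
  exists ((tofrac q)^-1 *: (tofrac p *: 'X_[mu])), (p *: 'X_[mu]), q.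
  rewrite !map_mpolyZ !map_mpolyX; split=> //.
  rewrite [RHS]scalerA; congr (_ *: _); apply: val_inj.
  by rewrite /= bE mulrC.
exists (\sum_(mu <- msupp b) a mu).
by have := specializes_sum (msupp b) aP; rewrite -mpolyE.
Qed.

Lemma specializes_mx_mul s t r (A : 'M[R]_(s, t)) (B : 'M[R]_(t, r)) A' B' :
  spec_mx A A' -> spec_mx B B' -> spec_mx (A *m B) (A' *m B').
Proof.
by move=> AA' BB' i j; rewrite !mxE; apply: specializes_sum => l; exact: specializesM.
Qed.

Lemma specializes_mxD s t (A B : 'M[R]_(s, t)) A' B' :
  spec_mx A A' -> spec_mx B B' -> spec_mx (A + B) (A' + B').
Proof. by move=> AA' BB' i j; rewrite !mxE; exact: specializesD. Qed.

Lemma specializes_mxN s t (A : 'M[R]_(s, t)) A' :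
  spec_mx A A' -> spec_mx (- A) (- A').
Proof. by move=> AA' i j; rewrite !mxE; exact: specializesN. Qed.

Lemma specializes_mxZ s t a b (A : 'M[R]_(s, t)) A' :
  spec a b -> spec_mx A A' -> spec_mx (a *: A) (b *: A').
Proof. by move=> ab AA' i j; rewrite !mxE; exact: specializesM. Qed.

Lemma specializes_mx0 s t : spec_mx (0 : 'M[R]_(s, t)) 0.
Proof. by move=> i j; rewrite !mxE; exact: specializes0. Qed.

Lemma specializes_mx_sum s t I (r : seq I) (f : I -> 'M[R]_(s, t)) g :
  (forall i, spec_mx (f i) (g i)) ->
  spec_mx (\sum_(i <- r) f i) (\sum_(i <- r) g i).
Proof.
by move=> fg i j; rewrite !summxE; apply: specializes_sum => x; exact: fg.
Qed.

Lemma specializes_mx_lift s t (B : 'M[Ra]_(s, t)) : exists A, spec_mx A B.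
Proof.
have /choice[a aP] : forall ij, exists a, spec a (B ij.1 ij.2).
  by move=> ij; exact: specializes_lift.
by exists (\matrix_(i, j) a (i, j)) => i j; rewrite mxE.
Qed.

Lemma specializes_mx_functional s t (A : 'M[R]_(s, t)) B B' :
  spec_mx A B -> spec_mx A B' -> B = B'.
Proof. by move=> AB AB'; apply/matrixP => i j; exact: specializes_functional. Qed.

End Specialization.

(** * Properties valid off a hypersurface *)

Lemma fraction_repr (D : idomainType) (x : {fraction D}) :
  exists2 q : D, q != 0 & exists p, x = (tofrac q)^-1 * tofrac p.
Proof.
elim/quotW: x => x; exists (frac x).2; first exact: denom_ratioP.
exists (frac x).1; apply: (canRL (mulKf _)); first by rewrite tofrac_eq0 denom_ratioP.
unlock FracField.tofrac; rewrite -[LHS]FracField.pi_mul; apply/eqmodP.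
by rewrite /= FracField.equivfE /FracField.mulf !numden_Ratio
  ?mul1r ?mulr1 ?mulf_neq0 ?denom_ratioP ?oner_neq0.
Qed.

(** A single polynomial over [k] cuts out the exceptional set, so finite conjunctions amount to
    products of polynomials. *)
Definition generically (k K : fieldType) (iota : {rmorphism k -> K}) m
    (P : ('I_m -> K) -> Prop) : Prop :=
  exists2 d : {mpoly k[m]}, d != 0 &
    forall alpha, evalA iota alpha d != 0 -> P alpha.

Section Generically.
Variables (k K : fieldType) (iota : {rmorphism k -> K}) (m : nat).
Implicit Types P Q : ('I_m -> K) -> Prop.

Lemma generically_mono P Q :
  (forall alpha, P alpha -> Q alpha) -> generically iota P -> generically iota Q.
Proof. by move=> PQ [d d0 dP]; exists d => // alpha /dP/PQ. Qed.

Lemma generically_true P : (forall alpha, P alpha) -> generically iota P.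
Proof. by exists 1; rewrite ?oner_neq0. Qed.

Lemma generically_and P Q :
  generically iota P -> generically iota Q ->
  generically iota (fun alpha => P alpha /\ Q alpha).
Proof.
move=> [d d0 dP] [e e0 eQ]; exists (d * e); first exact: mulf_neq0.
move=> alpha; rewrite rmorphM mulf_eq0 negb_or => /andP[da ea].
by split; [exact: dP|exact: eQ].
Qed.

Lemma generically_all (T : eqType) (s : seq T) (P : T -> ('I_m -> K) -> Prop) :
  (forall x, x \in s -> generically iota (P x)) ->
  generically iota (fun alpha => forall x, x \in s -> P x alpha).
Proof.
elim: s => [|x s IHs] sP; first exact: generically_true.
have [] := generically_and (sP x (mem_head x s)) (IHs _).
  by move=> y ys; apply: sP; rewrite inE ys orbT.
move=> d d0 dP; exists d => // alpha /dP[Px Ps] y.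
by rewrite inE => /predU1P[->|/Ps].
Qed.

(** The hypersurface of [d] is proper: since [k] is infinite, [d] is nonzero at some point with
    coordinates in [k], and the image of this point under the injective [iota] lies off the
    hypersurface. *)
Lemma almost_all_generically P :
  infinite_set [set: k]%classic -> generically iota P -> almost_all P.
Proof.
move=> inf_k [d d0 dP].
have dE a : (map_mpoly iota d).@[a] = evalK iota a d.
  rewrite /map_mpoly /evalK /mmap rmorph_sum /=; apply: eq_bigr => mu _.
  by rewrite mevalM mevalC mmap1_id mevalX.
exists (zero_locus [:: map_mpoly iota d]); split.
- by exists [:: map_mpoly iota d].
- have [a da] := mpoly_nonroot inf_k d0.
  move=> /(congr1 (fun V => V (fun i => iota (a i)))) locusE.
  have : zero_locus [:: map_mpoly iota d] (fun i => iota (a i)) by rewrite locusE.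
  move=> /(_ _ (mem_head _ _))/eqP; apply/negP.
  rewrite dE -(fmorph_eq0 iota) in da *; apply: contra_neq da => <-.
  rewrite mevalE rmorph_sum; apply: eq_bigr => mu _ /=.
  by rewrite rmorphM rmorph_prod; congr (_ * _); apply: eq_bigr => i _; rewrite rmorphXn.
- move=> a notV; apply: dP; apply: contra_notN notV => /eqP/(congr1 val) /= da.
  by move=> f; rewrite inE => /eqP->; rewrite dE.
Qed.

(** A polynomial has finitely many coefficients, so only finitely many denominators must be kept
    nonzero. *)
Lemma generically_specializes n (a : polyratfun k m n) :
  generically iota (fun alpha => exists b, specializes (iota := iota) (alpha := alpha) a b).
Proof.
apply: generically_mono (@generically_all _ (msupp a) (fun mu alpha =>
    exists b, specializes (iota := iota) (alpha := alpha) (a@_mu *: 'X_[mu]) b) _).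
  move=> alpha dmu.
  have /choice[b bP] : forall mu, exists b,
      specializes (iota := iota) (alpha := alpha) (a@_mu *: 'X_[mu]) b.
    move=> mu; have [/dmu//|/memN_msupp_eq0->] := boolP (mu \in msupp a).
    by exists 0; rewrite scale0r; exact: specializes0.
  exists (\sum_(mu <- msupp a) b mu).
  by have := specializes_sum (msupp a) bP; rewrite -mpolyE.
move=> mu _; have [q q0 [p ->]] := fraction_repr (a@_mu).
exists q => // alpha qa; exists ((evalA iota alpha q)^-1 *: map_mpoly (evalA iota alpha) (p *: 'X_[mu])).
by exists (p *: 'X_[mu]), q; split=> //; rewrite map_mpolyZ map_mpolyX scalerA.
Qed.

End Generically.

Lemma generically_specializes_mx (k K : fieldType) (iota : {rmorphism k -> K})
    m n s t (A : 'M[polyratfun k m n]_(s, t)) :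
  generically iota (fun alpha =>
    exists B, specializes_mx (iota := iota) (alpha := alpha) A B).
Proof.
have := @generically_all _ _ iota m _ (enum [set: 'I_s * 'I_t]) (fun ij alpha =>
  exists b, specializes (iota := iota) (alpha := alpha) (A ij.1 ij.2) b).
move=> /(_ (fun ij _ => generically_specializes iota (A ij.1 ij.2))).
apply: generically_mono => alpha Ab.
have /choice[b bP] : forall ij, exists b,
    specializes (iota := iota) (alpha := alpha) (A ij.1 ij.2) b.
  by move=> ij; apply: Ab; rewrite mem_enum inE.
exists (\matrix_(i, j) b (i, j)) => i j; rewrite mxE; exact: (bP (i, j)).
Qed.

(** * Linear forms and division by a Groebner basis *)

Section LinearForm.
Variables (L : fieldType) (n s : nat) (c : 'cV[{mpoly L[n]}]_s).
Local Notation V := 'rV[{mpoly L[n]}]_s.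

Definition linform (w : V) : {mpoly L[n]} := (w *m c) 0 0.

Lemma linformZ a w : linform (a *: w) = a * linform w.
Proof. by rewrite /linform -scalemxAl mxE. Qed.

Lemma linformB v w : linform (v - w) = linform v - linform w.
Proof. by rewrite /linform mulmxBl !mxE. Qed.

Lemma linformD v w : linform (v + w) = linform v + linform w.
Proof. by rewrite /linform mulmxDl !mxE. Qed.

Lemma linform0 : linform 0 = 0.
Proof. by rewrite /linform mul0mx mxE. Qed.

(** Coefficients enter as constants, so the extension is linear over [L] only, not over the
    polynomial ring. *)
Definition monomial_ext (Q : 'X_{1..n} -> V) (f : {mpoly L[n]}) : V :=
  \sum_(mu <- msupp f) (f@_mu)%:MP *: Q mu.

Lemma linform_monomial_ext Q f :
  f - linform (monomial_ext Q f) =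
  \sum_(mu <- msupp f) (f@_mu)%:MP * ('X_[mu] - linform (Q mu)).
Proof.
rewrite [f in f - _]mpolyE /monomial_ext.
rewrite (big_morph linform linformD linform0) -sumrB; apply: eq_bigr => mu _.
by rewrite linformZ mulrBr !mul_mpolyC.
Qed.

End LinearForm.

Lemma linform_colB (L : fieldType) n s r (C : 'M[{mpoly L[n]}]_(s, r)) j v w :
  linform (col j C) (v - w) = (v *m C - w *m C) 0 j.
Proof.
rewrite -mulmxBl /linform mxE [RHS]mxE.
by apply: eq_bigr => i _; rewrite [col _ _ _ _]mxE.
Qed.

Section IdealSection.
Variables (k K : fieldType) (iota : {rmorphism k -> K}) (m n s : nat).
Local Notation R := (polyratfun k m n).
Variables (M : 'rV[R]_s -> Prop) (c : 'cV[R]_s).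
Hypotheses (M0 : M 0) (MD : forall v w, M v -> M w -> M (v + w)).
Hypothesis (MZ : forall a v, M v -> M (a *: v)).

Lemma M_monomial_ext Q f : (forall mu, M (Q mu)) -> M (monomial_ext Q f).
Proof.
move=> MQ; rewrite /monomial_ext; elim: (msupp f) => [|mu r IHr].
  by rewrite big_nil.
by rewrite big_cons; apply: MD IHr; exact: MZ.
Qed.

(** The initial monomials of the ideal. Witnesses are monic, so that dividing by them inverts
    nothing further. *)
Let leading mu := exists w,
  [/\ M w, mleadc (linform c w) = 1 & mlead (linform c w) = mu].

Let leading_mlead w : M w -> linform c w != 0 -> leading (mlead (linform c w)).
Proof.
move=> Mw w0; set a := mleadc (linform c w).
have a0 : a != 0 by rewrite mleadc_eq0.
exists (a^-1%:MP *: w); rewrite linformZ mul_mpolyC mleadZ ?invr_neq0 //.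
by split; [exact: MZ | rewrite mcoeffZ mulVf |].
Qed.

(* [Q mu] reduces the monomial [mu]: ['X_[mu] - linform c (Q mu)] is a remainder,
   i.e. has no leading monomial of the ideal [linform c (M)] in its support. *)
Lemma monomial_section : exists Q : 'X_{1..n} -> 'rV[R]_s,
  [/\ forall mu, M (Q mu),
      generically iota (fun alpha => forall mu, exists w,
        specializes_mx (iota := iota) (alpha := alpha) (Q mu) w)
    & forall w, M w ->
        linform c (monomial_ext Q (linform c w)) = linform c w].
Proof.
(* The forms [linform c (W mu)] for [mu] in the finite [S] are a Groebner basis of the ideal. *)
have [S S_leading S_min] := dickson leading.
have /choice[W WP] : forall mu, exists w, mu \in S ->
    [/\ M w, mleadc (linform c w) = 1 & mlead (linform c w) = mu].
  move=> mu; have [/S_leading[w wP]|_] := boolP (mu \in S); last by exists 0.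
  by exists w.
(* The form is required to specialize separately from [W mu], since nothing is known about [c] at
   [alpha]. *)
have [d d0 dP] : generically iota (fun alpha => forall mu, mu \in S ->
    (exists w, specializes_mx (iota := iota) (alpha := alpha) (W mu) w) /\
    exists b, specializes (iota := iota) (alpha := alpha) (linform c (W mu)) b).
  apply: generically_all => mu _; apply: generically_and.
    exact: generically_specializes_mx.
  exact: generically_specializes.
(* The condition on [d] sits inside the invariant, so one [d] serves the infinitely many
   monomials. *)
have /choice[Q QP] : forall mu, exists y, [/\ M y,
    forall alpha, evalA iota alpha d != 0 ->
      exists w, specializes_mx (iota := iota) (alpha := alpha) y w
    & forall nu, leading nu -> ('X_[mu] - linform c y)@_nu = 0].
  elim/(@ltmwf n) => mu IHmu.
  have [lead_mu|nlead_mu] := pselect (leading mu); last first.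
    (* A monomial outside the initial ideal is its own remainder. *)
    exists 0; split=> // [alpha _|nu lead_nu].
      by exists 0; exact: specializes_mx0.
    rewrite linform0 subr0 mcoeffX; case: eqP => // mu_nu.
    by case: nlead_mu; rewrite mu_nu.
  have [mu' Smu' le_mu'] := S_min _ lead_mu.
  have [MW leadcW leadW] := WP _ Smu'.
  (* The multiple [w] makes the leading term of [linform c w] equal to ['X_[mu]], so [g] only has
     monomials below [mu], which are reduced by induction. *)
  pose w := 'X_[mu - mu'] *: W mu'.
  pose g := 'X_[mu] - linform c w.
  have W0 : linform c (W mu') != 0.
    by rewrite -mleadc_eq0 leadcW oner_neq0.
  have X0 : 'X_[mu - mu'] != 0 :> R by rewrite -msupp_eq0 msuppX.
  have leadw : mlead (linform c w) = mu.
    by rewrite linformZ mleadM // mleadXm leadW submK.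
  have leadcw : mleadc (linform c w) = 1.
    rewrite linformZ mleadM // mleadcM mleadXm mcoeffX eqxx leadcW mul1r //.
  have g_lt nu : nu \in msupp g -> (nu < mu)%O.
    rewrite mcoeff_msupp; apply: contraR; rewrite -Order.TotalTheory.leNgt.
    rewrite Order.POrderTheory.le_eqVlt mcoeffB mcoeffX => /predU1P[<-|mu_nu].
      by rewrite eqxx -leadw leadcw subrr.
    rewrite Order.POrderTheory.lt_eqF //= mcoeff_gt_mlead ?leadw //.
    by rewrite subrr.
  have /choice[Y YP] : forall nu, exists y, [/\ M y,
      forall alpha, evalA iota alpha d != 0 ->
        exists w, specializes_mx (iota := iota) (alpha := alpha) y w
      & nu \in msupp g ->
        forall xi, leading xi -> ('X_[nu] - linform c y)@_xi = 0].
    move=> nu; have [/g_lt/IHmu[y [? ? ?]]|_] := boolP (nu \in msupp g).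
      by exists y.
    by exists 0; split=> // alpha _; exists 0; exact: specializes_mx0.
  exists (w + monomial_ext Y g); split=> [|alpha da|nu lead_nu].
  - by apply: MD; [exact: MZ | apply: M_monomial_ext => nu; case: (YP nu)].
  - have [[W' WW'] [b Wb]] := dP _ da _ Smu'.
    have /choice[Y' YY'] : forall nu, exists w,
        specializes_mx (iota := iota) (alpha := alpha) (Y nu) w.
      by move=> nu; have [_ /(_ _ da)] := YP nu.
    have gg' := specializesD (specializesX iota alpha mu)
      (specializesN (specializesM (specializesX iota alpha (mu - mu')) Wb)).
    rewrite -linformZ -/w -/g in gg'; eexists; apply: specializes_mxD.
      exact: specializes_mxZ (specializesX iota alpha (mu - mu')) WW'.
    apply: specializes_mx_sum => nu; apply: specializes_mxZ (YY' nu).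
    exact: specializes_coef gg'.
  - rewrite linformD opprD addrA -/g linform_monomial_ext raddf_sum /=.
    rewrite big_seq big1 // => xi xi_g; rewrite mcoeffCM.
    by have [_ _ /(_ xi_g _ lead_nu)->] := YP xi; rewrite mulr0.
exists Q; split=> [mu||w Mw]; first by case: (QP mu).
  by exists d => // alpha da mu; have [_ /(_ _ da)] := QP mu.
(* The difference [h] lies in the ideal, so if nonzero its leading monomial is initial; being a
   remainder, it has coefficient zero there. *)
apply/esym/eqP; rewrite -subr_eq0; apply/negPn/negP.
set f := linform c w; set h := f - _ => h0.
have hE : h = linform c (w - monomial_ext Q f) by rewrite linformB.
have : mleadc h = 0.
  rewrite [h in h@_ _]linform_monomial_ext raddf_sum /= big1 // => mu _.
  rewrite mcoeffCM; have [_ _ ->] := QP mu; first by rewrite mulr0.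
  rewrite hE; apply: leading_mlead; rewrite -?hE //.
  apply: MD => //; rewrite -scaleN1r; apply: MZ.
  by apply: M_monomial_ext => nu; case: (QP nu).
by apply/eqP; rewrite mleadc_eq0.
Qed.

End IdealSection.

(** * Sections of matrices that specialize *)

Section Tame.
Variables (k K : fieldType) (iota : {rmorphism k -> K}) (m n : nat).
Local Notation R := (polyratfun k m n).
Local Notation spec_mx alpha :=
  (specializes_mx (iota := iota) (alpha := alpha)).

(* [h] is not assumed additive, so vanishing at [alpha] has to be preserved
   by a separate clause. *)
Definition tame alpha s t (h : 'rV[R]_s -> 'rV[R]_t) : Prop :=
  (forall v v', spec_mx alpha v v' -> exists w', spec_mx alpha (h v) w') /\
  (forall v, spec_mx alpha v 0 -> spec_mx alpha (h v) 0).

Lemma monomial_ext_specializes alpha s (Q : 'X_{1..n} -> 'rV[R]_s) Q' f f' :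
  (forall mu, spec_mx alpha (Q mu) (Q' mu)) ->
  specializes (iota := iota) (alpha := alpha) f f' ->
  spec_mx alpha (monomial_ext Q f) (\sum_(mu <- msupp f) (f'@_mu)%:MP *: Q' mu).
Proof.
move=> QQ' ff'; apply: specializes_mx_sum => mu; apply: specializes_mxZ => //.
exact: specializes_coef.
Qed.

(** Choice alone would give a section; the content is that one is [tame] off a single hypersurface,
    the same for all input vectors. *)
Lemma matrix_section s r (C : 'M[R]_(s, r)) :
  exists2 h : 'rV[R]_r -> 'rV[R]_s, generically iota (fun alpha => tame alpha h) &
    forall w, h (w *m C) *m C = w *m C.
Proof.
suff H t : (t <= r)%N -> exists2 h : 'rV[R]_r -> 'rV[R]_s,
    generically iota (fun alpha => tame alpha h) &
    forall w (j : 'I_r), (j < t)%N -> linform (col j C) (w - h (w *m C)) = 0.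
  have [h h_tame hP] := H r (leqnn r); exists h => [|w]; first exact: h_tame.
  apply/esym/eqP; rewrite -subr_eq0; apply/eqP/rowP => j.
  by rewrite -linform_colB hP ?ltn_ord // [RHS]mxE.
(* Column by column: the error left on column [t] by a section for the previous
   columns is corrected inside the module [M] of rows that they annihilate. *)
elim: t => [_|t IHt ltr].
  exists (fun=> 0) => [|w j]; last by rewrite ltn0.
  apply: generically_true => alpha.
  by split=> [v v' _|v _]; [exists 0|]; exact: specializes_mx0.
have [h h_tame hP] := IHt (ltnW ltr); pose j0 := Ordinal ltr.
pose M (w : 'rV[R]_s) := forall j : 'I_r, (j < t)%N -> linform (col j C) w = 0.
have M0 : M 0 by move=> j _; exact: linform0.
have MD v w : M v -> M w -> M (v + w).
  by move=> Mv Mw j jt; rewrite linformD (Mv j jt) (Mw j jt) addr0.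
have MZ a v : M v -> M (a *: v).
  by move=> Mv j jt; rewrite linformZ (Mv j jt) mulr0.
have [Q [MQ Q_spec QP]] := monomial_section iota (col j0 C) M0 MD MZ.
exists (fun v => h v + monomial_ext Q ((v - h v *m C) 0 j0)).
  have := generically_and h_tame (generically_and Q_spec
    (generically_specializes_mx iota C)).
  apply: generically_mono => alpha [[h1 h2] [/choice[Q' QQ'] [C' CC']]].
  have diff v v' w' : spec_mx alpha v v' -> spec_mx alpha (h v) w' ->
      spec_mx alpha (v - h v *m C) (v' - w' *m C').
    move=> vv' ww'; apply: specializes_mxD => //; apply: specializes_mxN.
    exact: specializes_mx_mul.
  split=> [v v' vv'|v v0].
    have [w' ww'] := h1 _ _ vv'; eexists; apply: (specializes_mxD ww').
    exact: monomial_ext_specializes QQ' (diff _ _ _ vv' ww' 0 j0).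
  (* When [v] specializes to 0, so does the error on column [j0]; all coefficients of the correction
     then specialize to 0. *)
  have := monomial_ext_specializes QQ' (diff _ _ _ v0 (h2 _ v0) 0 j0).
  rewrite mul0mx subr0 big1 => [|mu _]; last first.
    by rewrite mxE mcoeff0 mpolyC0 scale0r.
  by move=> /(specializes_mxD (h2 _ v0)); rewrite addr0.
(* The error on column [j0] is the form of [w1], which lies in [M], so [QP] removes it. The
   correction lies in [M] and leaves the earlier columns alone. *)
move=> w j jt; set v := w *m C; pose w1 := w - h v.
have Mw1 : M w1 by move=> i; exact: hP.
rewrite -linform_colB -/w1 opprD addrA -/w1 linformB.
move: jt; rewrite ltnS leq_eqVlt => /predU1P[/= jt|jt].
  by rewrite (_ : j = j0) ?(QP _ Mw1) ?subrr //; exact: val_inj.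
by rewrite (Mw1 j jt) (M_monomial_ext M0 MD MZ _ MQ j jt) subr0.
Qed.

End Tame.

(** * Passage to coordinates *)

Section Coordinates.
Variable S : nzRingType.

Lemma is_basis_eq0 (V : lmodType S) r (e : 'I_r -> V) (c : 'rV[S]_r) :
  is_basis e -> \sum_i c 0 i *: e i = 0 -> c = 0.
Proof.
move=> e_basis c0; have [b [_ b_uniq]] := e_basis 0.
rewrite -[LHS](b_uniq c) // -[RHS](b_uniq 0) //.
by rewrite big1 // => i _; rewrite mxE scale0r.
Qed.

Lemma is_matrix_sum (V W : lmodType S) r s (e : 'I_r -> V) (f : 'I_s -> W)
    (phi : {linear V -> W}) (A : 'M[S]_(r, s)) (c : 'rV[S]_r) :
  is_matrix e f phi A ->
  phi (\sum_i c 0 i *: e i) = \sum_j (c *m A) 0 j *: f j.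
Proof.
move=> phiA; rewrite linear_sum /=.
under eq_bigr => i _ do rewrite linearZ /= phiA scaler_sumr.
rewrite exchange_big; apply: eq_bigr => j _ /=.
by rewrite mxE scaler_suml; apply: eq_bigr => i _; rewrite scalerA.
Qed.

Variables (l : nat) (r : nat -> nat) (F : nat -> lmodType S).
Variables (e : forall i, 'I_(r i) -> F i) (phi : forall i, {linear F i.+1 -> F i}).
Variable A : forall i, 'M[S]_(r i.+1, r i).
Hypothesis e_basis : forall i, (i <= l)%N -> is_basis (@e i).
Hypothesis phiA : forall i, (i < l)%N -> is_matrix (@e i.+1) (@e i) (phi i) (A i).

(** Specialization acts on matrices, so exactness is first carried from the abstract modules to row
    vectors, using uniqueness of coordinates. *)
Lemma exact_complex_mx : exact_complex l phi -> exact_complex l (mx_complex A).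
Proof.
have phi0 i (c : 'rV[S]_(r i.+1)) : (i < l)%N ->
    phi i (\sum_j c 0 j *: @e i.+1 j) = 0 <-> c *m A i = 0.
  move=> il; rewrite (is_matrix_sum c (phiA il)); split=> [|->].
    by apply: is_basis_eq0; apply: e_basis; exact: ltnW.
  by rewrite big1 // => j _; rewrite mxE scale0r.
move=> [inj exa]; split=> [i il v /= vA|i il v /=].
  have {}il' : (i < l)%N by rewrite -il.
  apply: (is_basis_eq0 (e_basis il')); apply: inj => //.
  exact/(phi0 _ _ il').
have il' := ltnW il; rewrite -(phi0 _ _ il'); split.
  move=> /(exa _ il)[w].
  have [c [-> _]] := e_basis il w; rewrite (is_matrix_sum c (phiA il)) => vE.
  exists c; have [b [_ b_uniq]] := e_basis il' (\sum_j v 0 j *: @e i.+1 j).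
  by rewrite -(b_uniq v) // -(b_uniq (c *m A i.+1)).
move=> [w ->]; apply/(exa _ il).
by exists (\sum_j w 0 j *: @e i.+2 j); rewrite (is_matrix_sum w (phiA il)).
Qed.

End Coordinates.

(** * Transfer of exactness to the specialized complex *)

Section SpecializeExact.
Variables (k K : fieldType) (iota : {rmorphism k -> K}) (m n : nat).
Variable alpha : 'I_m -> K.
Local Notation R := (polyratfun k m n).
Local Notation Ra := {mpoly (adjoin iota alpha)[n]}.
Variables (l : nat) (r : nat -> nat) (A : forall i, 'M[R]_(r i.+1, r i)).
Variables (B : forall i, 'M[Ra]_(r i.+1, r i)).
Variables (h : forall i, 'rV[R]_(r i) -> 'rV[R]_(r i.+1)).
Hypothesis AB : forall i, (i < l)%N -> specializes_mx (A i) (B i).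
Hypothesis h_tame : forall i, (i < l)%N -> tame iota alpha (@h i).
Hypothesis hP : forall i (w : 'rV[R]_(r i.+1)), h (w *m A i) *m A i = w *m A i.

Lemma exact_complex_specializes :
  exact_complex l (mx_complex A) -> exact_complex l (mx_complex B).
Proof.
move=> [inj exa].
have hA0 i v v' : (i < l)%N -> specializes_mx v v' -> v' *m B i = 0 ->
    specializes_mx (h (v *m A i)) (0 : 'rV[Ra]_(r i.+1)).
  move=> il vv' vB; apply: (h_tame il).2; rewrite -vB.
  by apply: specializes_mx_mul => //; exact: AB.
split=> [i il v' /= vB|i il v' /=].
  have il' : (i < l)%N by rewrite -il.
  have [v vv'] := specializes_mx_lift v'.
  (* In top degree injectivity over R makes [h] recover [v] itself, which therefore specializes to
     0. *)
  have vE : h (v *m A i) = v.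
    apply/eqP; rewrite -subr_eq0; apply/eqP/(inj i il).
    by rewrite /= mulmxBl hP subrr.
  apply: (specializes_mx_functional vv').
  by rewrite -[in specializes_mx v _]vE; exact: hA0.
have il' := ltnW il; split=> [vB|[w' ->]].
  have [v vv'] := specializes_mx_lift v'.
  (* The subtracted term specializes to 0, so [z] is a genuine cycle over R that still lifts
     [v']. *)
  pose z := v - h (v *m A i).
  have zv' : specializes_mx z v'.
    have := specializes_mxD vv' (specializes_mxN (hA0 _ _ _ il' vv' vB)).
    by rewrite subr0.
  have [w zE] : exists w, z = w *m A i.+1.
    by apply/(exa i il); rewrite /= mulmxBl hP subrr.
  (* The preimage [w] need not specialize, but the preimage [h z] does. *)
  have [w' ww'] := (h_tame il).1 _ _ zv'.
  exists w'; apply: (specializes_mx_functional zv').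
  have -> : z = h z *m A i.+1 by rewrite zE hP.
  by apply: specializes_mx_mul ww' _; exact: AB.
(* Boundaries are cycles: the zero product over R specializes both to 0 and to the product over
   k(alpha)[x]. *)
have [w ww'] := specializes_mx_lift w'.
have wB := specializes_mx_mul (specializes_mx_mul ww' (AB il)) (AB il').
apply: (specializes_mx_functional wB).
have -> : w *m A i.+1 *m A i = 0 by apply/(exa i il); exists w.
exact: specializes_mx0.
Qed.

End SpecializeExact.

Theorem theorem1p5 (k K : fieldType) (iota : {rmorphism k -> K})
    (k_infinite : infinite_set [set: k]%classic) (m n : nat)
    (l : nat) (r : nat -> nat) (F : nat -> lmodType (polyratfun k m n))
    (e : forall i, 'I_(r i) -> F i)
    (e_basis : forall i, (i <= l)%N -> is_basis (e i))
    (phi : forall i, {linear F i.+1 -> F i})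
    (A : forall i, 'M[polyratfun k m n]_(r i.+1, r i))
    (phiA : forall i, (i < l)%N -> is_matrix (e i.+1) (e i) (phi i) (A i))
    (F_exact : exact_complex l phi) :
  almost_all (fun alpha : 'I_m -> K =>
    exists B : forall i, 'M[{mpoly (adjoin iota alpha)[n]}]_(r i.+1, r i),
      (forall i, (i < l)%N -> specializes_mx (A i) (B i)) /\
      exact_complex l (mx_complex B)).
Proof.
apply: (almost_all_generically (iota := iota)) => //.
have /all_sig2[h h_tame hP] := fun i => cid2 (matrix_section iota (A i)).
(* Only the [l] differentials below index [l] impose conditions, so a finite conjunction
   suffices. *)
apply: generically_mono (@generically_all _ _ iota m _ (seq.iota 0 l)
  (fun i alpha => tame iota alpha (h i) /\
     exists B, specializes_mx (iota := iota) (alpha := alpha) (A i) B) _); last first.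
  move=> i _; apply: generically_and; last exact: generically_specializes_mx.
  exact: h_tame.
move=> alpha good.
have good_lt i : (i < l)%N -> tame iota alpha (h i) /\
    exists B, specializes_mx (iota := iota) (alpha := alpha) (A i) B.
  by move=> il; apply: good; rewrite mem_iota.
(* [B] must be given at every index; from [l] on, it is set to 0. *)
have /all_sig[B AB] i : {B | (i < l)%N ->
    specializes_mx (iota := iota) (alpha := alpha) (A i) B}.
  apply: cid; have [/good_lt[_ [B AB]]|_] := ltnP i l; first by exists B.
  by exists 0.
exists B; split; first exact: AB.
apply: (exact_complex_specializes AB _ hP (exact_complex_mx e_basis phiA F_exact)).
by move=> i /good_lt[].
Qed.
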